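(* Let $(M(s))_{s\in S}$ be the mixed moments on the noncommutative plane $\mathcal{B}_0=\mathbf{C}\langle X,X'\rangle$ in some state $\widehat{\phi}$. Then the corresponding admissible cumulants $(L(s))_{s\in S^+}$ are given by $$L(s)=\sum_{u\le s}m(u)M(u),\qquad s\in S^+,$$ where the sum runs over all $u\in\mathcal{AP}(s)$, $M(u)=M(u_1)\cdots M(u_p)$ for $u=(u_1,\ldots,u_p)$, and $m(u)=m(u|s)$ is the M\''obius function of $\mathcal{AP}(s)$ evaluated at $u$ and the one-word partition $s$.
   Context: $S=FS(\{z,w\})$ is the free semigroup of all finite words in $z,w$ including the empty word $1$; $S^{+}=S\setminus\{1\}$; $l(s)$ is the length of $s$. A subword of $s=s_1\ldots s_n$ is a subsequence $s_{i_1}\ldots s_{i_k}$, $1\le i_1<\ldots<i_k\le n$, with its indices remembered (when a function on $S$ is evaluated at a subword, the subword is regarded simply as a word). A partition of $s\in S^+$ is a sequence $u=(u_1,\ldots,u_p)$ of nonempty subwords with pairwise disjoint index sets whose union is $\{1,\ldots,n\}$, ordered by increasing first index. A letter $s_j$ not belonging to $u_l=s_{i_1}\ldots s_{i_k}$ is inner with respect to $u_l$ if $i_1<j<i_k$. The partition $u$ is admissible if no letter equal to $w$ is inner with respect to any word $u_l$ of $u$ to which it does not belong. $\mathcal{AP}(s)$ is the set of admissible partitions of $s$, partially ordered by refinement ($v\le u$ iff $v$ is a, not necessarily proper, refinement of $u$); its maximal element is the one-word partition, denoted $s$. The M\''obius function is defined by $m(u|u)=1$ and $m(u|v)=-\sum_{u\le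 t<v}m(u|t)$ for $u<v$ in $\mathcal{AP}(s)$. $\mathcal{B}_0=\mathbf{C}\langle X,X'\rangle$ is the unital free *-algebra on two self-adjoint generators; write $X(z)=X$, $X(w)=X'$. The moments are $M(s)=\widehat{\phi}(X(s_1)\cdots X(s_n))$ for $s=s_1\ldots s_n$, and $M(1)=1$. The admissible cumulants $(L(s))_{s\in S^+}$ are defined recursively by $M(s)=\sum_{p=1}^{l(s)}\sum_{u=(u_1,\ldots,u_p)\in\mathcal{AP}(s)}L(u_1)\cdots L(u_p)$ for $s\in S^+$. *)

(* Defs.v *)
From HB Require Import structures.
From mathcomp Require Import all_boot all_order all_algebra.
From mathcomp Require Import finmap complex reals.
From mathcomp.multinomials Require Import monalg.

Set Implicit Arguments.
Unset Strict Implicit.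
Unset Printing Implicit Defensive.

Import Order.TTheory GRing.Theory Num.Theory.
Local Open Scope ring_scope.
Local Open Scope complex_scope.

Inductive letter := Lz | Lw.

Definition bool_of_letter (x : letter) : bool := if x is Lw then true else false.
Definition letter_of_bool (b : bool) : letter := if b then Lw else Lz.
Lemma bool_of_letterK : cancel bool_of_letter letter_of_bool.
Proof. by case. Qed.
HB.instance Definition _ := Finite.copy letter (can_type bool_of_letterK).

(* The free semigroup FS({z,w}), with empty word [::]; S^+ is cut out by
   [s != [::]]. *)
Notation word := (seq letter).

(* A subword of s is given by the set of its indices; [enum] lists them in
   increasing order, so [subword s B] is the subword read as a plain word. *)
Definition subword (s : word) (B : {set 'I_(size s)}) : word :=
  [seq tnth (in_tuple s) i | i <- enum B].

(* With B = {i_1 < ... < i_k}: j is not in B and i_1 < j < i_k. *)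
Definition inner (n : nat) (B : {set 'I_n}) (j : 'I_n) : bool :=
  [&& j \notin B, [exists i in B, (i < j)%N] & [exists k in B, (j < k)%N]].

(* The words of a partition are ordered by their first index, so the sequence
   (u_1, ..., u_p) carries the same data as the set {u_1, ..., u_p} of its
   blocks. [partition] requires nonempty, disjoint, covering blocks. *)
Definition admissible (s : word) (P : {set {set 'I_(size s)}}) : bool :=
  partition P [set: 'I_(size s)] &&
  [forall B in P, forall j, inner B j ==> (tnth (in_tuple s) j != Lw)].

Record AP (s : word) := MkAP {
  blocks : {set {set 'I_(size s)}};
  _ : admissible blocks
}.

HB.instance Definition _ s := [isSub for @blocks s].
HB.instance Definition _ s := [Finite of AP s by <:].

Lemma AP_partition s (u : AP s) : partition (blocks u) [set: 'I_(size s)].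
Proof. by case: u => P /= /andP[]. Qed.

Definition refines (s : word) (v u : AP s) : bool :=
  [forall B in blocks v, exists C in blocks u, B \subset C].

Lemma refinesP s (v u : AP s) :
  reflect (forall B, B \in blocks v -> exists2 C, C \in blocks u & B \subset C)
          (refines v u).
Proof.
apply: (iffP forall_inP) => H B /H; first by case/exists_inP => C; exists C.
by case=> C uC sBC; apply/exists_inP; exists C.
Qed.

Lemma refines_refl s : reflexive (@refines s).
Proof. by move=> u; apply/refinesP => B uB; exists B. Qed.

Lemma refines_trans s : transitive (@refines s).
Proof.
move=> v u t /refinesP uv /refinesP vt; apply/refinesP => B /uv[C vC sBC].
by have [D tD sCD] := vt _ vC; exists D => //; apply: subset_trans sCD.
Qed.

Lemma refines_sub s (u v : AP s) :
  refines u v -> refines v u -> {subset blocks u <= blocks v}.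
Proof.
move=> /refinesP uv /refinesP vu B uB.
have [C vC sBC] := uv _ uB; have [D uD sCD] := vu _ vC.
have /and3P[_ /trivIsetP triv n0] := AP_partition u.
have BD : B = D.
  apply/eqP; apply: contraT => neBD; have := triv _ _ uB uD neBD.
  rewrite -setI_eq0 (setIidPl (subset_trans sBC sCD)) => /eqP B0.
  by move: n0; rewrite -B0 uB.
suff -> : B = C by [].
by apply/eqP; rewrite eqEsubset sBC BD sCD.
Qed.

Lemma refines_anti s : antisymmetric (@refines s).
Proof.
move=> u v /andP[uv vu]; apply/val_inj/setP => B /=.
by apply/idP/idP; apply: refines_sub.
Qed.

Fact refine_display : Order.disp_t. Proof. exact: Order.Disp tt tt. Qed.

HB.instance Definition _ s := Order.Le_isPOrder.Build refine_display (AP s)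
  (@refines_refl s) (@refines_anti s) (@refines_trans s).

Lemma one_word_admissible (s : word) :
  s != [::] -> @admissible s [set [set: 'I_(size s)]].
Proof.
move=> s0; apply/andP; split.
  apply/and3P; split; first by rewrite /cover big_set1.
    by apply/trivIsetP => A B /set1P-> /set1P->; rewrite eqxx.
  rewrite inE eq_sym; case: s s0 => // x s _.
  by apply/set0Pn; exists ord0; rewrite inE.
apply/forall_inP => B /set1P->; apply/forallP => j.
by rewrite /inner in_setT.
Qed.

Definition one_word (s : word) (hs : s != [::]) : AP s :=
  MkAP (one_word_admissible hs).

Lemma le_one_word (s : word) (hs : s != [::]) (u : AP s) :
  (u <= one_word hs)%O.
Proof. by apply/refinesP => B _; exists setT; rewrite ?inE ?subsetT. Qed.

Section Moebius.
Variables (d : Order.disp_t) (T : finPOrderType d).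

(* m(u|v) by recursion on v; the fuel k bounds the number of elements below v,
   and [moebiusE] shows that it plays no role. m(u|v) = 0 unless u <= v. *)
Fixpoint moebius_rec (k : nat) (u v : T) : int :=
  if u == v then 1 else
  if k is k'.+1 then - \sum_(t : T | (u <= t < v)%O) moebius_rec k' u t else 0.

Definition moebius (u v : T) : int := moebius_rec #|[set t | (t < v)%O]| u v.

Lemma moebius_rec_fuel k l u v :
  (#|[set t | (t < v)%O]| <= k)%N -> (#|[set t | (t < v)%O]| <= l)%N ->
  moebius_rec k u v = moebius_rec l u v.
Proof.
have lt_card t x : (t < x)%O ->
    (#|[set y | (y < t)%O]| < #|[set y | (y < x)%O]|)%N.
  move=> tx; apply/proper_card/properP; split.
    by apply/subsetP => y; rewrite !inE => /lt_trans; apply.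
  by exists t; rewrite !inE ?tx ?ltxx.
elim: k l v => [|k IH] [|l] v le_k le_l //=; case: eqP => // _.
- rewrite big1 ?oppr0 // => t /andP[_ /lt_card tv].
  by have := leq_trans tv le_k.
- rewrite big1 ?oppr0 // => t /andP[_ /lt_card tv].
  by have := leq_trans tv le_l.
congr (- _); apply: eq_bigr => t /andP[_ /lt_card tv].
by apply: IH; rewrite -ltnS; apply: leq_trans tv _.
Qed.

Lemma moebiusxx u : moebius u u = 1.
Proof. by rewrite /moebius; case: #|_| => [|k] /=; rewrite eqxx. Qed.

Lemma moebiusE u v :
  (u < v)%O -> moebius u v = - \sum_(t : T | (u <= t < v)%O) moebius u t.
Proof.
move=> uv; rewrite /moebius (@moebius_rec_fuel _ #|[set t | (t < v)%O]|.+1) //=.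
rewrite (lt_eqF uv); congr (- _); apply: eq_bigr => t /andP[_ tv].
apply: moebius_rec_fuel => //; apply/subset_leq_card/subsetP => y.
by rewrite !inE => /lt_trans; apply.
Qed.

End Moebius.

(* The monoid algebra over R[i] of the free monoid on two letters, i.e. the
   free unital algebra C<X,X'>. *)
Notation plane R := {malg R[i][{fmonom letter}]}.

(* X(z) = X and X(w) = X'. *)
Definition gen (R : realType) (x : letter) : plane R := << FMonom [:: x] >>.

(* The conjugate-linear involution that reverses words; it is the unique
   *-structure for which X and X' are self-adjoint. *)
Definition star (R : realType) (a : plane R) : plane R :=
  \sum_(k <- msupp a) << (a@_k)^* *g FMonom (rev k) >>.

Lemma mcoeff_star (R : realType) (a : plane R) k :
  (star a)@_k = (a@_(FMonom (rev k)))^*.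
Proof.
rewrite raddf_sum /=.
under eq_bigr => i _ do rewrite mcoeffU.
have revE (i : {fmonom letter}) : (FMonom (rev i) == k) = (i == FMonom (rev k)).
  by rewrite !fmP /=; apply/eqP/eqP => [<-|->]; rewrite revK.
under eq_bigr => i _ do rewrite revE.
case: (msuppP a (FMonom (rev k))) => ka.
  rewrite (big_fsetD1 _ ka) /= eqxx big1_fset ?addr0 // => i.
  by rewrite in_fsetD1 => /andP[/negPf-> _].
rewrite conjc0 big1_fset // => i ia _.
by case: eqP ia ka => // -> ->.
Qed.

Lemma star_semilinear (R : realType) (c : R[i]) (a b : plane R) :
  star (c *: a + b) = c^* *: star a + star b.
Proof.
apply/malgP => k.
by rewrite mcoeff_star !(mcoeffD, mcoeffZ) !mcoeff_star rmorphD rmorphM.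
Qed.

Lemma starU (R : realType) (c : R[i]) k :
  star << c *g k >> = << c^* *g FMonom (rev k) >> :> plane R.
Proof.
apply/malgP => l; rewrite mcoeff_star !mcoeffU.
have -> : (k == FMonom (rev l)) = (FMonom (rev k) == l).
  by rewrite !fmP /=; apply/eqP/eqP => [->|<-]; rewrite revK.
by case: eqP; rewrite ?mulr1n ?mulr0n ?conjc0.
Qed.

Lemma starK (R : realType) : involutive (@star R).
Proof. by move=> a; apply/malgP => k; rewrite !mcoeff_star /= revK fmK conjcK. Qed.

Lemma star_gen (R : realType) x : star (gen R x) = gen R x.
Proof. by rewrite starU; congr << _ *g _ >>; apply: conjc1. Qed.

Lemma starM (R : realType) (a b : plane R) : star (a * b) = star b * star a.
Proof.
have star_sum (I : Type) (r : seq I) (F : I -> plane R) :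
    star (\sum_(i <- r) F i) = \sum_(i <- r) star (F i).
  have D x y : star (x + y) = star x + star y :> plane R.
    by apply/malgP => k; rewrite mcoeff_star !mcoeffD !mcoeff_star rmorphD.
  by apply: big_morph => //; apply: (addIr (star 0)); rewrite -D !add0r.
rewrite malgME star_sum [in RHS]/star big_distrlr exchange_big /=.
apply: eq_bigr => k _; rewrite star_sum; apply: eq_bigr => l _.
rewrite starU rmorphM mulrC malgM_def fgmulUU; congr << _ *g _ >>.
by apply/eqP; rewrite fmP fmM /= fmM rev_cat.
Qed.

Definition is_state (R : realType) (phi : plane R -> R[i]) : Prop :=
  [/\ forall c a b, phi (c *: a + b) = c * phi a + phi b,
      phi 1 = 1
    & forall a, 0 <= phi (star a * a)].

(* M(s), with M(1) = phi 1 = 1 by the empty product. *)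
Definition moment (R : realType) (phi : plane R -> R[i]) (s : word) : R[i] :=
  phi (\prod_(x <- s) gen R x).

(* F(u) = F(u_1) ... F(u_p) for u = (u_1, ..., u_p); the factors commute. *)
Definition mult_ext (C : comNzRingType) (F : word -> C) (s : word) (u : AP s) :
  C := \prod_(B in blocks u) F (subword B).

(* The defining recursion; the value of L at the empty word is irrelevant, since
   blocks are nonempty. *)
Definition admissible_cumulants (C : comNzRingType) (M L : word -> C) : Prop :=
  forall s : word, s != [::] ->
    M s = \sum_(1 <= p < (size s).+1)
            \sum_(u : AP s | #|blocks u| == p) mult_ext L u.

Section CumulantsExist.
Variables (C : comNzRingType) (M : word -> C).

Fixpoint cumulant_rec (k : nat) (s : word) : C :=
  if k is k'.+1 then
    M s - \sum_(u : AP s | blocks u != [set [set: 'I_(size s)]])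
            mult_ext (cumulant_rec k') u
  else 0.

Lemma subwordT s : subword [set: 'I_(size s)] = s.
Proof.
rewrite /subword -[RHS](map_tnth_enum (in_tuple s)).
by congr map; apply: eq_enum => i; rewrite inE.
Qed.

Lemma size_subword s (B : {set 'I_(size s)}) : size (subword B) = #|B|.
Proof. by rewrite size_map cardE. Qed.

Lemma size_block s (u : AP s) (B : {set 'I_(size s)}) :
  blocks u != [set setT] -> B \in blocks u -> (#|B| < size s)%N.
Proof.
move=> uT uB; have /and3P[_ /trivIsetP triv n0] := AP_partition u.
suff: (#|B| < #|[set: 'I_(size s)]|)%N by rewrite cardsT card_ord.
apply: proper_card.
rewrite properT; apply: contra uT => /eqP BT; rewrite BT in uB.
apply/eqP/setP => D; rewrite inE; apply/idP/eqP => [uD|-> //].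
apply/eqP; apply: contraT => DT; have := triv _ _ uD uB DT.
by rewrite -setI_eq0 setIT => /eqP D0; rewrite -D0 uD in n0.
Qed.

Lemma cumulant_rec_fuel k l s :
  (size s <= k)%N -> (size s <= l)%N -> s != [::] ->
  cumulant_rec k s = cumulant_rec l s.
Proof.
elim: k l s => [|k IH] [|l] [|x s] //= sk sl _.
congr (_ - _); apply: eq_bigr => u uT; apply: eq_bigr => B uB.
have lt_B := @size_block (x :: s) u B uT uB; rewrite -size_subword /= in lt_B.
apply: IH; try by rewrite -ltnS; apply: leq_trans lt_B _.
rewrite -size_eq0 size_subword cards_eq0.
by have /and3P[_ _] := AP_partition u; apply: contra => /eqP <-.
Qed.

Lemma sum_AP s (F : AP s -> C) : s != [::] ->
  \sum_(1 <= p < (size s).+1) \sum_(u : AP s | #|blocks u| == p) F u =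
  \sum_(u : AP s) F u.
Proof.
move=> s0; rewrite (exchange_big_dep xpredT) //=; apply: eq_bigr => u _.
have /and3P[/eqP cov triv n0] := AP_partition u.
have u_gt0 : (0 < #|blocks u|)%N.
  rewrite card_gt0; apply: contraNneq s0 => u0; move: cov.
  rewrite /cover u0 big_set0 -size_eq0 => /(congr1 (fun A => #|pred_of_set A|)).
  by rewrite cards0 cardsT card_ord => <-.
have u_le : (#|blocks u| <= size s)%N.
  suff: (#|blocks u| <= #|[set: 'I_(size s)]|)%N by rewrite cardsT card_ord.
  rewrite -cov -(eqP triv) -sum1_card.
  apply: leq_sum => B uB; rewrite card_gt0.
  by apply: contra n0 => /eqP <-.
under eq_bigl => p do rewrite eq_sym.
by rewrite big_nat1_eq u_gt0 ltnS u_le.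
Qed.

Lemma admissible_cumulants_exist : exists L, admissible_cumulants M L.
Proof.
exists (fun s => cumulant_rec (size s) s) => s s0.
rewrite sum_AP // (bigD1 (one_word s0)) //= {1}/mult_ext big_set1 subwordT.
have -> : cumulant_rec (size s) s =
    M s - \sum_(u : AP s | blocks u != [set setT])
            mult_ext (cumulant_rec (size s).-1) u by case: s s0.
set S := \sum_(u | _) _; rewrite [X in _ = _ + X](_ : _ = S) ?subrK //.
apply: eq_bigr => u uT; apply: eq_bigr => B uB.
have lt_B := size_block uT uB; rewrite -size_subword in lt_B.
apply: cumulant_rec_fuel => //; first by case: (size s) lt_B.
rewrite -size_eq0 size_subword cards_eq0.
by have /and3P[_ _] := AP_partition u; apply: contra => /eqP <-.
Qed.

End CumulantsExist.

(* Main.v *)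
(* For an admissible u, the admissible v <= u are exactly the choices of an
   admissible partition of each block of u, read as a word: a letter w inner to
   a block C of v and outside the block B of u containing C would be inner to B.
   Multiplying the defining recursion over the blocks of u thus gives
   M(u) = sum over v <= u of L(v), and Moebius inversion at the one-word
   partition gives the theorem. *)

Require Import Defs.
From mathcomp Require Import all_boot all_order all_algebra.
From mathcomp Require Import finmap complex reals.
From mathcomp.multinomials Require Import monalg.
Import Order.TTheory GRing.Theory Num.Theory.
Local Open Scope ring_scope.
Local Open Scope complex_scope.

Set Implicit Arguments.
Unset Strict Implicit.
Unset Printing Implicit Defensive.

Section MoebiusInversion.
Variables (d : Order.disp_t) (T : finPOrderType d).

Lemma sum_moebius (u v : T) :
  \sum_(t : T | (u <= t <= v)%O) moebius u t = (u == v)%:R.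
Proof.
case: (altP (u =P v)) => [<-|uv].
  rewrite (big_pred1 u) ?moebiusxx // => t.
  by rewrite -eq_le eq_sym.
have [le_uv|nle_uv] := boolP (u <= v)%O; last first.
  by rewrite big1 // => t /andP[ut /(le_trans ut)]; rewrite (negPf nle_uv).
rewrite (bigD1 v) ?le_uv ?lexx //= moebiusE; last by rewrite lt_neqAle uv.
apply/eqP; rewrite addrC subr_eq0; apply/eqP; apply: eq_bigl => t.
by rewrite -andbA [(t <= v)%O && _]andbC -lt_neqAle.
Qed.

(* [sum_moebius] says that moebius is a left inverse of zeta in the incidence
   algebra; realised as square matrices, it is also a right inverse. *)
Lemma sum_moebius_dual (u v : T) :
  \sum_(t : T | (u <= t <= v)%O) moebius t v = (u == v)%:R.
Proof.
pose mob := \matrix_(i, j < #|T|)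
  if (enum_val i <= enum_val j)%O then moebius (enum_val i) (enum_val j) else 0.
pose zeta := \matrix_(i, j < #|T|) ((enum_val i <= enum_val j)%O%:R : int).
have mob_zeta : mob *m zeta = 1%:M.
  apply/matrixP => i j; rewrite !mxE -(inj_eq enum_val_inj) -sum_moebius.
  rewrite [RHS]big_mkcond [RHS](reindex _ (onW_bij _ (enum_val_bij T))) /=.
  apply: eq_bigr => k _; rewrite !mxE.
  by do 2!case: (_ <= _)%O => //=; rewrite ?mulr0 ?mulr1 ?mul0r.
have := congr1 (fun A : 'M_#|T| => A (enum_rank u) (enum_rank v))
  (mulmx1C mob_zeta).
rewrite !mxE (inj_eq enum_rank_inj) => <-.
rewrite big_mkcond (reindex _ (onW_bij _ (enum_val_bij T))) /=.
apply: eq_bigr => k _; rewrite !mxE !enum_rankK.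
by do 2!case: (_ <= _)%O => //=; rewrite ?mulr0 ?mul1r ?mul0r.
Qed.

Lemma moebius_inversion (C : nzRingType) (f g : T -> C) :
  (forall u, g u = \sum_(t | (t <= u)%O) f t) ->
  forall v, f v = \sum_(u | (u <= v)%O) (moebius u v)%:~R * g u.
Proof.
move=> gE v; under eq_bigr => u _ do rewrite gE big_distrr.
rewrite (exchange_big_dep xpredT) //=.
have inner_sum t : \sum_(u | (u <= v)%O && (t <= u)%O) (moebius u v)%:~R * f t
    = (t == v)%:R * f t.
  rewrite -big_distrl -raddf_sum /=; congr (_ * _).
  under eq_bigl => u do rewrite andbC.
  by rewrite sum_moebius_dual; case: eqP.
rewrite (eq_bigr _ (fun t _ => inner_sum t)) (bigD1 v) //= eqxx mul1r.
by rewrite big1 ?addr0 // => t /negPf->; rewrite mul0r.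
Qed.

End MoebiusInversion.

Definition admissible_on (s : word) (D : {set 'I_(size s)})
    (P : {set {set 'I_(size s)}}) : bool :=
  partition P D &&
  [forall B in P, forall j in D, inner B j ==> (tnth (in_tuple s) j != Lw)].

Lemma admissible_onT (s : word) (P : {set {set 'I_(size s)}}) :
  admissible_on [set: 'I_(size s)] P = admissible P.
Proof.
congr (_ && _); apply: eq_forallb_in => B _.
by apply: eq_forallb => j; rewrite inE.
Qed.

Lemma sum_AP_blocks (A : comNzRingType) (s : word)
    (G : {set {set 'I_(size s)}} -> A) :
  \sum_(w : AP s) G (blocks w) = \sum_(P | admissible P) G P.
Proof.
rewrite (reindex_omap (@blocks s) insub) => [|P admP]; last by rewrite insubT.
apply: eq_bigl => w; rewrite -[blocks w]/(val w) valK eqxx andbT.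
by case: w.
Qed.

Lemma sorted_enum_ord n (A : {set 'I_n}) :
  sorted (fun i j : 'I_n => i < j)%N (enum A).
Proof.
rewrite {1}/enum_mem; apply: sorted_filter.
  by move=> ? ? ?; apply: ltn_trans.
by have := iota_ltn_sorted 0 n; rewrite -val_enum_ord sorted_map enumT.
Qed.

Section Transfer.
Variables (s t : word) (h : 'I_(size t) -> 'I_(size s)).
Hypothesis h_mono : forall i j, (h i < h j)%N = (i < j)%N.
Hypothesis h_letter : forall i, tnth (in_tuple s) (h i) = tnth (in_tuple t) i.

Let h_inj : injective h.
Proof.
move=> i j hij; have [ij|ij|/val_inj//] := ltngtP i j.
  by have := h_mono i j; rewrite hij ltnn ij.
by have := h_mono j i; rewrite hij ltnn ij.
Qed.

Lemma enum_imset_mono (C : {set 'I_(size t)}) : enum (h @: C) = map h (enum C).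
Proof.
apply: (@irr_sorted_eq _ (fun i j : 'I_(size s) => i < j)%N).
- by move=> ? ? ?; apply: ltn_trans.
- by move=> i; rewrite ltnn.
- exact: sorted_enum_ord.
- rewrite (mono_sorted (e := fun i j : 'I_(size t) => i < j)%N) //.
  exact: sorted_enum_ord.
move=> i; rewrite mem_enum; apply/imsetP/mapP => -[x xC ->]; exists x => //.
  by rewrite mem_enum.
by rewrite mem_enum in xC.
Qed.

Lemma subword_imset (C : {set 'I_(size t)}) : subword (h @: C) = subword C.
Proof.
by rewrite /subword enum_imset_mono -map_comp; exact: eq_map.
Qed.

Lemma inner_imset (C : {set 'I_(size t)}) j : inner (h @: C) (h j) = inner C j.
Proof.
rewrite /inner mem_imset //; congr [&& _, _ & _].
  apply/exists_inP/exists_inP => [[_ /imsetP[i iC ->]]|[i iC]] hij.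
    by exists i => //; rewrite -h_mono.
  by exists (h i); rewrite ?h_mono ?imset_f.
apply/exists_inP/exists_inP => [[_ /imsetP[i iC ->]]|[i iC]] hij.
  by exists i => //; rewrite -h_mono.
by exists (h i); rewrite ?h_mono ?imset_f.
Qed.

Lemma admissible_imset (P : {set {set 'I_(size t)}}) :
  admissible_on (h @: setT) [set h @: C | C : {set 'I_(size t)} in P]
  = admissible P.
Proof.
rewrite -admissible_onT /admissible_on imset_partition //; congr (_ && _).
apply/forall_inP/forall_inP => adm B.
  move=> BP; apply/forall_inP => j _.
  have /forall_inP/(_ (h j)) := adm _ (imset_f _ BP).
  by rewrite imset_f ?inE // inner_imset h_letter; apply.
case/imsetP => C CP ->; apply/forall_inP => _ /imsetP[j jT ->].
by rewrite inner_imset h_letter; have /forall_inP/(_ _ jT) := adm _ CP.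
Qed.

Lemma sum_mult_ext_transfer (A : comNzRingType) (F : word -> A) :
  \sum_(w : AP t) mult_ext F w =
  \sum_(P | admissible_on (h @: setT) P) \prod_(C in P) F (subword C).
Proof.
pose push (P : {set {set 'I_(size t)}}) :=
  [set h @: C | C : {set 'I_(size t)} in P].
pose pull (P : {set {set 'I_(size s)}}) :=
  [set h @^-1: C | C : {set 'I_(size s)} in P].
have pushK (P : {set {set 'I_(size t)}}) : pull (push P) = P.
  rewrite /pull /push -imset_comp -[RHS]imset_id; apply: eq_imset => /= C.
  by apply/setP => i; rewrite inE mem_imset.
have pullK P : admissible_on (h @: setT) P -> push (pull P) = P.
  case/andP => partP _; rewrite /pull /push -imset_comp -[RHS]imset_id.
  apply: eq_in_imset => C CP /=; apply/setP => i.
  apply/imsetP/idP => [[j]|iC]; first by rewrite inE => jC ->.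
  have /imsetP[j _ ij] : i \in h @: setT.
    by rewrite -(cover_partition partP); apply/bigcupP; exists C.
  by exists j; rewrite // inE -ij.
rewrite (reindex_onto push pull pullK).
under [RHS]eq_bigl => P do rewrite pushK eqxx andbT admissible_imset.
rewrite (sum_AP_blocks (fun P => \prod_(C in P) F (subword C))).
apply: eq_bigr => P _; rewrite big_imset /=; last exact: in2W (imset_inj h_inj).
by apply: eq_bigr => C _; rewrite subword_imset.
Qed.

End Transfer.

Lemma sum_mult_ext_subword (A : comNzRingType) (F : word -> A) (s : word)
    (B : {set 'I_(size s)}) :
  \sum_(w : AP (subword B)) mult_ext F w =
  \sum_(P | admissible_on B P) \prod_(C in P) F (subword C).
Proof.
pose h i : 'I_(size s) := enum_val (cast_ord (size_subword B) i).
have hT : h @: setT = B.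
  apply/setP => j; apply/imsetP/idP => [[i _ ->]|jB]; first exact: enum_valP.
  exists (cast_ord (esym (size_subword B)) (enum_rank_in jB j)) => //.
  by rewrite /h cast_ordKV enum_rankK_in.
rewrite -[in RHS]hT; apply: sum_mult_ext_transfer.
  have h_homo (i j : 'I_(size (subword B))) : (i < j)%N -> (h i < h j)%N.
    rewrite /h !(enum_val_nth (h i)) => ij.
    apply: (sorted_ltn_nth (leT := fun k l : 'I_(size s) => k < l)%N) => //.
    - by move=> ? ? ?; apply: ltn_trans.
    - exact: sorted_enum_ord.
    - by rewrite inE -cardE; apply: ltn_ord.
    - by rewrite inE -cardE; apply: ltn_ord.
  move=> i j; have [|ji|/val_inj->] := ltngtP i j; last by rewrite ltnn.
    exact: h_homo.
  by apply/negbTE; rewrite -leqNgt ltnW // h_homo.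
move=> i; rewrite [RHS](tnth_nth Lz) /=.
rewrite (nth_map (h i)) -?cardE -?(size_subword B) //.
by congr tnth; apply: enum_val_nth.
Qed.

Lemma partition_block_inj (T : finType) (P : {set {set T}}) (D B C : {set T}) x :
  partition P D -> B \in P -> C \in P -> x \in B -> x \in C -> B = C.
Proof.
case/and3P => _ triv _ BP CP xB xC.
by rewrite -(def_pblock triv BP xB) (def_pblock triv CP xC).
Qed.

Lemma inner_letter (s : word) (w : AP s) B j :
  B \in blocks w -> inner B j -> tnth (in_tuple s) j != Lw.
Proof.
by case: w => P /= /andP[_ /forall_inP adm] /adm/forallP/(_ j)/implyP.
Qed.

Section Refinements.
Variables (s : word) (u : AP s).

Definition restrict (v : {set {set 'I_(size s)}}) (B : {set 'I_(size s)}) :=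
  [set C in v | C \subset B].

Lemma restrict_admissible (v : AP s) (B : {set 'I_(size s)}) :
  (v <= u)%O -> B \in blocks u -> admissible_on B (restrict (blocks v) B).
Proof.
move=> /refinesP vu uB; have partv := AP_partition v.
have /and3P[_ /trivIsetP triv v0] := partv.
apply/andP; split.
  apply/and3P; split.
  - apply/eqP/setP => x; apply/bigcupP/idP => [[C]|xB].
      by rewrite inE => /andP[_ /subsetP]; apply.
    have : x \in cover (blocks v) by rewrite (cover_partition partv) inE.
    case/bigcupP => C vC xC; exists C => //; rewrite inE vC.
    have [D uD sCD] := vu _ vC.
    have xD := subsetP sCD _ xC.
    by rewrite (partition_block_inj (AP_partition u) uB uD xB xD).
  - apply/trivIsetP => C D; rewrite !inE => /andP[vC _] /andP[vD _].
    exact: triv.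
  - by rewrite inE (negPf v0).
apply/forall_inP => C; rewrite inE => /andP[vC _].
by apply/forall_inP => j _; apply/implyP; apply: inner_letter vC.
Qed.

Lemma bigcup_admissible (f : {set 'I_(size s)} -> {set {set 'I_(size s)}}) :
  (forall B, B \in blocks u -> admissible_on B (f B)) ->
  admissible (\bigcup_(B in blocks u) f B).
Proof.
move=> adm; have partu := AP_partition u.
have part B : B \in blocks u -> partition (f B) B by move=> /adm/andP[].
have sub B C : B \in blocks u -> C \in f B -> C \subset B.
  by move=> uB; apply/partitionS/part.
apply/andP; split.
  apply/and3P; split.
  - apply/eqP/setP => x; rewrite inE.
    have : x \in cover (blocks u) by rewrite (cover_partition partu) inE.
    case/bigcupP => B uB; rewrite -(cover_partition (part _ uB)).
    case/bigcupP => C fC xC; apply/bigcupP; exists C => //.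
    by apply/bigcupP; exists B.
  - apply/trivIsetP => C D /bigcupP[B uB fC] /bigcupP[B' uB' fD] neCD.
    apply/pred0Pn => -[x /andP[/= xC xD]].
    have BB' : B = B'.
      by apply: partition_block_inj partu uB uB' (subsetP (sub _ _ uB fC) _ xC)
        (subsetP (sub _ _ uB' fD) _ xD).
    rewrite -BB' in fD; case/eqP: neCD.
    exact: partition_block_inj (part _ uB) fC fD xC xD.
  - apply/negP => /bigcupP[B uB].
    by have /and3P[_ _ /negPf->] := part _ uB.
apply/forall_inP => C /bigcupP[B uB fC]; apply/forallP => j.
apply/implyP => innC; have [jB|jnB] := boolP (j \in B).
  have /andP[_ /forall_inP/(_ _ fC)/forall_inP/(_ _ jB)/implyP] := adm _ uB.
  exact.
apply: (inner_letter uB).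
case/and3P: innC => _ /exists_inP[i iC ij] /exists_inP[k kC jk].
apply/and3P; split=> //; apply/exists_inP.
  by exists i => //; apply: subsetP (sub _ _ uB fC) _ iC.
by exists k => //; apply: subsetP (sub _ _ uB fC) _ kC.
Qed.

Lemma prod_sum_blocks (A : comNzRingType) (G : {set 'I_(size s)} -> A) :
  \prod_(B in blocks u) \sum_(P | admissible_on B P) \prod_(C in P) G C =
  \sum_(v : AP s | (v <= u)%O) \prod_(C in blocks v) G C.
Proof.
have partu := AP_partition u.
rewrite (big_distr_big_dep set0) /=.
pose merge (f : {ffun {set 'I_(size s)} -> {set {set 'I_(size s)}}}) : AP s :=
  insubd u (\bigcup_(B in blocks u) f B).
pose restrictions (v : AP s) :
    {ffun {set 'I_(size s)} -> {set {set 'I_(size s)}}} :=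
  [ffun B => if B \in blocks u then restrict (blocks v) B else set0].
have blocks_merge (f : {ffun {set 'I_(size s)} -> {set {set 'I_(size s)}}}) :
    (forall B, B \in blocks u -> admissible_on B (f B)) ->
    blocks (merge f) = \bigcup_(B in blocks u) f B.
  by move=> adm; rewrite -[LHS]/(val _) val_insubd bigcup_admissible.
have restrictionsK f :
    f \in pfamily set0 [in blocks u] (fun B => @admissible_on s B) ->
    restrictions (merge f) = f.
  case/pfamilyP => supp_f adm; apply/ffunP => B; rewrite ffunE.
  case: ifPn => [uB|uB].
    rewrite /restrict blocks_merge //; apply/setP => C; rewrite inE.
    apply/andP/idP => [[/bigcupP[B' uB' fC] sCB]|fC].
      have sCB' : C \subset B'.
        by apply: partitionS fC; case/andP: (adm _ uB').
      have [x xC] : exists x, x \in C.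
        apply/set0Pn; have /andP[/and3P[_ _ n0] _] := adm _ uB'.
        by apply: contraNneq n0 => <-.
      by rewrite (partition_block_inj partu uB uB' (subsetP sCB _ xC)
        (subsetP sCB' _ xC)).
    split; first by apply/bigcupP; exists B.
    by apply: partitionS fC; case/andP: (adm _ uB).
  apply/esym/eqP; apply: contraNT uB => fB.
  exact: (subsetP supp_f).
rewrite (reindex_onto restrictions merge restrictionsK).
have restrictions_pfamily v : (v <= u)%O ->
    restrictions v \in pfamily set0 [in blocks u] (fun B => @admissible_on s B).
  move=> vu; apply/pfamilyP; split=> [|B uB].
    by apply/subsetP => B; rewrite inE ffunE; case: ifP => //; rewrite eqxx.
  by rewrite ffunE [B \in blocks u]uB; apply: restrict_admissible.
have bigcup_restrictions v : (v <= u)%O ->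
    \bigcup_(B in blocks u) restrictions v B = blocks v.
  move=> /refinesP vu; apply/setP => C; apply/bigcupP/idP => [[B uB]|vC].
    by rewrite ffunE uB inE => /andP[].
  by have [B uB sCB] := vu _ vC; exists B; rewrite // ffunE uB inE vC.
have restrictions_le v : restrictions v \in pfamily set0 [in blocks u]
    (fun B => @admissible_on s B) -> merge (restrictions v) = v -> (v <= u)%O.
  case/pfamilyP => _ adm vE; apply/refinesP => C.
  rewrite -vE blocks_merge // => /bigcupP[B uB fC]; exists B => //.
  by apply: partitionS fC; case/andP: (adm _ uB).
apply: eq_big => [v|v /andP[fam /eqP vE]].
  apply/andP/idP => [[fam /eqP]|vu]; first exact: restrictions_le.
  have fam := restrictions_pfamily _ vu; split=> //.
  case/pfamilyP: fam => _ adm.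
  by apply/eqP/val_inj; rewrite /= blocks_merge // bigcup_restrictions.
have vu := restrictions_le _ fam vE.
under eq_bigr => B uB.
  rewrite ffunE uB.
  rewrite (eq_bigl (fun C => (C \in blocks v) && (C \subset B))); last first.
    by move=> C; rewrite inE.
  over.
rewrite (exchange_big_dep [in blocks v]) /= => [|B C _ /andP[]//].
apply: eq_bigr => C vC; have /refinesP/(_ _ vC)[B uB sCB] := vu.
have /set0Pn[x xC] : C != set0.
  have /and3P[_ _ n0] := AP_partition v.
  by apply: contraNneq n0 => <-.
apply: big_pred1 => B'; rewrite /= vC /=.
apply/andP/eqP => [[uB' sCB']|->]; last exact: conj uB sCB.
exact: partition_block_inj partu uB' uB (subsetP sCB' _ xC) (subsetP sCB _ xC).
Qed.

End Refinements.

Lemma mult_ext_cumulants (A : comNzRingType) (M L : word -> A) (s : word)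
    (u : AP s) :
  admissible_cumulants M L ->
  mult_ext M u = \sum_(v : AP s | (v <= u)%O) mult_ext L v.
Proof.
move=> ML; rewrite -prod_sum_blocks; apply: eq_bigr => B uB.
have B0 : subword B != [::].
  rewrite -size_eq0 size_subword cards_eq0.
  by have /and3P[_ _] := AP_partition u; apply: contraNneq => <-.
by rewrite -sum_mult_ext_subword ML // sum_AP.
Qed.

Theorem theorem5p3 (R : realType) (phi : plane R -> R[i]) (hphi : is_state phi)
    (L : word -> R[i]) (hL : admissible_cumulants (moment phi) L)
    (s : word) (hs : s != [::]) :
  L s = \sum_(u : AP s | (u <= one_word hs)%O)
          (moebius u (one_word hs))%:~R * mult_ext (moment phi) u.
Proof.
have -> : L s = mult_ext L (one_word hs) by rewrite /mult_ext big_set1 subwordT.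
apply: (moebius_inversion (f := @mult_ext _ L s)
  (g := @mult_ext _ (moment phi) s)) => u.
exact: mult_ext_cumulants.
Qed.
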